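(* Let $M$ be a compact surface without boundary, let $r\ge 1$, and let $F:M\times\mathbb{S}^1\rightarrow M\times\mathbb{S}^1$ be a skew-product of the form $F(p,t)=(f(p),t+\gamma(p))$, where $f:M\to M$ is a conservative Anosov $C^r$ diffeomorphism and $\gamma\in C^r(M;\mathbb{S}^1)$. If $\gamma$ is a coboundary relative to $f$ with transfer map $\mu\in C^1(M;\mathbb{S}^1)$, then there exists a $DF$-invariant codimension $1$ subbundle $\xi\subset T(M\times\mathbb{S}^1)$, transversal to $T\mathbb{S}^1$, such that for any hypersurface $S\subset M\times\mathbb{S}^1$ transversal to $T\mathbb{S}^1$ the characteristic foliation of $\xi$ in $S$ is represented by a vector field $X_\xi$ on $S$ that is locally hamiltonian.
   Context: $\mathbb{S}^1=\mathbb{R}/\mathbb{Z}$, written additively. $T\mathbb{S}^1$ denotes the line subbundle of $T(M\times\mathbb{S}^1)$ tangent to the fibers $\{p\}\times\mathbb{S}^1$. ''Conservative'' means area-preserving (with respect to an area form on $M$). Coboundary: $\gamma$ is a coboundary relative to $f$ with transfer map $\mu:M\to\mathbb{S}^1$ if $\gamma=\mu\circ f-\mu$. Characteristic foliation: for a surface $S$ in a $3$-manifold $N$ and a codimension $1$ subbundle $\xi\subset TN$, the characteristic foliation of $\xi$ in $S$ is the (singular) foliation of $S$ generated by the field of directions $\xi\cap TS$; its singular points are the points where $\xi$ is tangent to $S$. A field of directions is regarded as an equivalence class of vector fields modulo multiplication by strictly positive $C^\infty$ functions, and a vector field in the class is said to represent the characteristic foliation (a characteristic vector field). It may be only continuous.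 Hamiltonian vector fields: on a symplectic manifold $(S,\omega)$ with a riemannian metric $g$ and an almost complex structure $\mathbf{J}$ ($\mathbf{J}^2=-\mathrm{I}$) that are compatible, i.e. $\omega(u,\mathbf{J}v)=g(u,v)$ and $g(\mathbf{J}u,v)=\omega(u,v)$, the hamiltonian vector field of a $C^k$ function $H$ is $X_H=-\mathbf{J}\,\mathrm{grad}(H)$, the gradient being taken with respect to $g$ (equivalently $\iota_{X_H}\omega=dH$). A vector field is locally hamiltonian if every point has a neighborhood on which it equals $X_H$ for some function $H$ defined there. On a surface $S$ transversal to $T\mathbb{S}^1$, the symplectic (area) form is the pullback to $S$, under the projection $M\times\mathbb{S}^1\to M$, of the area form on $M$. *)

(* Defs.v *)
From HB Require Import structures.
From mathcomp Require Import all_boot all_order all_algebra.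
From mathcomp Require Import all_classical all_reals all_analysis.
From mathcomp Require Import ring lra.

Set Implicit Arguments.
Unset Strict Implicit.
Unset Printing Implicit Defensive.

Import Order.TTheory GRing.Theory Num.Theory.
Import numFieldNormedType.Exports.

Local Open Scope classical_set_scope.
Local Open Scope ring_scope.

(* For [U] open: [f] is of class C^k on [U]. *)
Fixpoint Ck_on {R : realType} {V W : normedModType R} (k : nat)
    (U : set V) (f : V -> W) : Prop :=
  if k is k'.+1 then
    (forall x, U x -> differentiable f x) /\
    (forall v, Ck_on k' U (fun x => 'd f x v))
  else forall x, U x -> {for x, continuous f}.

(* An atlas indexed by the points of the manifold: [chart_map p] is a chart at
   [p], defined on [chart_dom p], with inverse [chart_inv p].  Any atlas yields
   such a family (choose a chart around each point) generating the same smooth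
   structure.  The tangent space at [p] is the model space [E], a tangent
   vector being identified with its coordinates in the chart at [p]. *)
Record atlas {R : realType} (E : normedModType R) (T : topologicalType) := Atlas {
  chart_dom : T -> set T;
  chart_map : T -> T -> E;
  chart_inv : T -> E -> T }.

Definition chart_codom {R : realType} {E : normedModType R}
    {T : topologicalType} (A : atlas E T) (p : T) : set E :=
  chart_map A p @` chart_dom A p.

(* C^oo manifold without boundary, modelled on E *)
Definition is_manifold {R : realType} {E : normedModType R}
    {T : topologicalType} (A : atlas E T) : Prop :=
  [/\ hausdorff_space T,
      @second_countable T,
      (forall p, [/\ chart_dom A p p,
                     open (chart_dom A p),
                     open (chart_codom A p),
                     {within chart_dom A p, continuous (chart_map A p)} &
                     {within chart_codom A p, continuous (chart_inv A p)}]),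
      (forall p q, chart_dom A p q ->
         chart_inv A p (chart_map A p q) = q) &
      (forall p q k,
         Ck_on k (chart_map A p @` (chart_dom A p `&` chart_dom A q))
           (chart_map A q \o chart_inv A p))].

Section Maps.
Context {R : realType} {E F : normedModType R} {T T' : topologicalType}.
Variables (A : atlas E T) (B : atlas F T').

Definition Ck_map_on (k : nat) (U : set T) (h : T -> T') : Prop :=
  (forall p, U p -> {for p, continuous h}) /\
  (forall p q,
     Ck_on k
       (chart_map A p @` (U `&` chart_dom A p `&` h @^-1` chart_dom B q))
       (chart_map B q \o h \o chart_inv A p)).

Definition Ck_map (k : nat) (h : T -> T') : Prop := Ck_map_on k setT h.

(* D h at p, from T_p T to T_(h p) T' *)
Definition tmap (h : T -> T') (p : T) : {linear E -> F} :=
  'd (chart_map B (h p) \o h \o chart_inv A p) (chart_map A p p).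

End Maps.

Section Fields.
Context {R : realType} {E : normedModType R} {T : topologicalType}.
Variable A : atlas E T.

(* Differential at [z] of the change of charts from the one at [p] to the one
   at [q].  For [z] in both domains, [chart_change z q] is the isomorphism from
   T_z T to the coordinates at [q], and [chart_change q z] its inverse. *)
Definition chart_change (p q z : T) : {linear E -> E} :=
  'd (chart_map A q \o chart_inv A p) (chart_map A p z).

Definition continuous_vector_field_on (U : set T) (X : T -> E) : Prop :=
  forall q, {within U `&` chart_dom A q,
    continuous (fun z => chart_change z q z (X z))}.

Definition Ck_tensor2 (k : nat) (w : T -> E -> E -> R) : Prop :=
  forall q u v, Ck_on k (chart_codom A q)
    (fun x => let z := chart_inv A q x in
       w z (chart_change q z z u) (chart_change q z z v) : R^o).

End Fields.

Section BilinearAlgebra.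
Context {R : realType} {E : normedModType R}.
Implicit Types (w g : E -> E -> R).

Definition bilinear_form w : Prop :=
  (forall u, scalar (w u)) /\ (forall v, scalar (w^~ v)).

Definition inner_product g : Prop :=
  [/\ bilinear_form g,
      (forall u v, g u v = g v u) &
      (forall u, u != 0 -> 0 < g u u)].

Definition symplectic_form w : Prop :=
  [/\ bilinear_form w,
      (forall u, w u u = 0) &
      (forall u, (forall v, w u v = 0) -> u = 0)].

Definition compatible w g (J : E -> E) : Prop :=
  [/\ inner_product g,
      linear J /\ (forall v, J (J v) = - v),
      (forall u v, w u (J v) = g u v) &
      (forall u v, g (J u) v = w u v)].

(* [x = - J G], where [G] is the gradient with respect to [g] of a function
   with differential [a] *)
Definition hamiltonian_vector g (J : E -> E) (a : E -> R) (x : E) : Prop :=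
  exists2 G, (forall v, g G v = a v) & x = - J G.

End BilinearAlgebra.

Lemma symplectic_compatible_exists {R : realType}
    (w : 'rV[R]_2 -> 'rV[R]_2 -> R) : symplectic_form w ->
  exists g J, compatible w g J.
Proof.
move=> [[wl wr] walt wnd].
pose e (k : 'I_2) : 'rV[R]_2 := delta_mx 0 k.
have eE (u : 'rV[R]_2) : u = u 0 0 *: e 0 + u 0 1 *: e 1.
  by rewrite [LHS]row_sum_delta !big_ord_recl big_ord0 addr0; congr (_ + _ *: delta_mx _ _); 
   [congr (u _ _)|]; apply/val_inj.
pose c := w (e 0) (e 1).
have wlin b u v z : w (b *: u + v) z = b * w u z + w v z.
  exact: (wr z b u v).
have wrin b u v z : w z (b *: u + v) = b * w z u + w z v.
  exact: (wl z b u v).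
have w0l v : w 0 v = 0 by have := wlin (-1) 0 0 v; rewrite scaler0 addr0; lra.
have w0r v : w v 0 = 0 by have := wrin (-1) 0 0 v; rewrite scaler0 addr0; lra.
have wZl b u v : w (b *: u) v = b * w u v by have := wlin b u 0 v; rewrite addr0 w0l addr0.
have wZr b u v : w v (b *: u) = b * w v u by have := wrin b u 0 v; rewrite addr0 w0r addr0.
have c10 : w (e 1) (e 0) = - c.
  have := walt (1 *: e 0 + e 1); rewrite wlin !wrin !walt /c; lra.
have wE u v : w u v = c * (u 0 0 * v 0 1 - u 0 1 * v 0 0).
  rewrite [u in LHS]eE [v in LHS]eE wlin wZl !wrin !wZr !walt c10 /c; ring.
have c0 : c != 0.
  apply/eqP => c0; have : e 0 = 0 by apply: wnd => v; rewrite wE c0 mul0r.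
  by move/rowP/(_ 0)/eqP; rewrite !mxE !eqxx oner_eq0.
pose J (v : 'rV[R]_2) : 'rV[R]_2 := Num.sg c *: (v 0 0 *: e 1 - v 0 1 *: e 0).
have J0 v : J v 0 0 = - (Num.sg c * v 0 1).
  by rewrite /J !mxE /=; ring.
have J1 v : J v 0 1 = Num.sg c * v 0 0.
  by rewrite /J !mxE /=; ring.
have sg2 : Num.sg c * Num.sg c = 1 by rewrite -expr2 sqr_sg c0.
have rowE (u v : 'rV[R]_2) : u 0 0 = v 0 0 -> u 0 1 = v 0 1 -> u = v.
  by move=> h0 h1; rewrite (eE u) (eE v) h0 h1.
pose g u v := w u (J v).
have gE u v : g u v = `|c| * (u 0 0 * v 0 0 + u 0 1 * v 0 1).
  by rewrite /g wE J0 J1 normrEsg; ring.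
exists g, J; split => //.
- split; last 2 first.
  + by move=> u v; rewrite !gE; ring.
  + move=> u u0; rewrite gE mulr_gt0 ?normr_gt0// -!expr2 lt_def addr_ge0 ?sqr_ge0// andbT.
    apply: contra u0; rewrite paddr_eq0 ?sqr_ge0// !sqrf_eq0 => /andP[/eqP h0 /eqP h1].
    by apply/eqP/rowE; rewrite ?h0 ?h1 mxE.
  split=> u b x y /=; rewrite !gE !mxE; ring.
- split=> [b u v|v]; apply: rowE; rewrite !(J0, J1, mxE); try ring.
  + by rewrite mulrA sg2 mul1r.
  + by rewrite mulrN mulrA sg2 mul1r.
- move=> u v; rewrite gE wE J0 J1 normrEsg.
  transitivity (c * (Num.sg c * Num.sg c) * (u 0 0 * v 0 1 - u 0 1 * v 0 0)); last by rewrite sg2; ring.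
  by ring.
Qed.

Lemma hamiltonian_vectorP {R : realType} (w : 'rV[R]_2 -> 'rV[R]_2 -> R)
    (a : 'rV[R]_2 -> R) (x : 'rV[R]_2) : symplectic_form w ->
  (forall g J, compatible w g J -> hamiltonian_vector g J a x) <->
  (forall v, w x v = a v).
Proof.
move=> sw; split=> [h v|h g J [ig [Jl JJ] h1 h2]].
- have [g [J cJ]] := symplectic_compatible_exists sw; have [G Ga ->] := h _ _ cJ.
  have [_ [Jl JJ] _ h2] := cJ.
  by rewrite -h2 -Ga; congr g; rewrite -[- J G]JJ !JJ opprK.
- by exists (J x) => [v|]; rewrite ?h2// JJ opprK.
Qed.

(* a normed space as a manifold *)
Definition flat_atlas {R : realType} (E : normedModType R) : atlas E E :=
  Atlas (fun=> setT) (fun=> id) (fun=> id).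

Section Surfaces.
Context {R : realType} {T : topologicalType}.
Local Notation plane := 'rV[R]_2.
Variable A : atlas plane T.

Definition riemannian_metric (g : T -> plane -> plane -> R) : Prop :=
  (forall p, inner_product (g p)) /\ (forall k, Ck_tensor2 A k g).

Definition area_form (w : T -> plane -> plane -> R) : Prop :=
  (forall p, symplectic_form (w p)) /\ (forall k, Ck_tensor2 A k w).

(* The absolute values allow [f] to reverse the orientation. *)
Definition area_preserving (w : T -> plane -> plane -> R) (f : T -> T) : Prop :=
  forall p u v, `|w (f p) (tmap A A f p u) (tmap A A f p v)| = `|w p u v|.

Definition anosov_diffeo (r : nat) (f : T -> T) : Prop :=
  exists f' : T -> T,
  [/\ cancel f f' /\ cancel f' f,
      Ck_map A A r f /\ Ck_map A A r f' &
  exists (g : T -> plane -> plane -> R) (Es Eu : T -> {vspace plane}) (c l : R),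
  let norm p v := Num.sqrt (g p v v) in
  [/\ riemannian_metric g,
      0 < c /\ 0 < l < 1,
      (forall p, (Es p + Eu p = fullv)%VS /\ (Es p :&: Eu p = 0)%VS),
      (forall p, (linfun (tmap A A f p) @: Es p = Es (f p))%VS /\
                 (linfun (tmap A A f p) @: Eu p = Eu (f p))%VS) &
      (forall n p v,
        (v \in Es p ->
          norm (iter n f p) (tmap A A (iter n f) p v) <= c * l ^+ n * norm p v) /\
        (v \in Eu p ->
          norm (iter n f' p) (tmap A A (iter n f') p v) <= c * l ^+ n * norm p v))]].

(* By [hamiltonian_vectorP] a compatible pair (metric, complex structure)
   exists at each point where [w] is symplectic, and every such pair gives the
   same hamiltonian vector, so that the choice of the pair is immaterial. *)
Definition locally_hamiltonian (w : T -> plane -> plane -> R)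
    (X : T -> plane) : Prop :=
  forall p, exists (U : set T) (H : T -> R^o),
  [/\ open U /\ U p,
      Ck_map_on A (flat_atlas R^o) 1 U H &
      forall z, U z -> forall g J, compatible (w z) g J ->
        hamiltonian_vector g J
          (tmap A (flat_atlas R^o) H z) (X z)].

End Surfaces.

Definition integers (R : realType) : zmodClosed R :=
  GRing.ZmodClosed.clone R (@archimedean.Num.int_num_subdef R) _.

(* S^1 = R/Z *)
Definition circle (R : realType) : Type :=
  quotient_topology {ideal_quot integers R}.

HB.instance Definition _ (R : realType) := Topological.on (circle R).
HB.instance Definition _ (R : realType) :=
  GRing.Zmodule.copy (circle R) {ideal_quot integers R}.

(* The chart at z is the inverse of the projection R -> R/Z restricted to the
   interval of radius 1/2 centered at a representative of z. *)
Definition circle_atlas (R : realType) : atlas (R^o) (circle R) :=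
  Atlas
    (fun z : circle R => [set y : circle R | y != z + (\pi_(circle R) (2^-1 : R))%qT])
    (fun z y : circle R => let s : R := repr y - repr z + 2^-1 in
                (repr z + (s - (Num.floor s)%:~R) - 2^-1 : R))
    (fun (z : circle R) (x : R) => (\pi_(circle R) x)%qT).

Definition prod_atlas {R : realType} {E F : normedModType R}
    {T T' : topologicalType} (A : atlas E T) (B : atlas F T') :
    atlas (E * F)%type (T * T')%type :=
  Atlas (fun p => chart_dom A p.1 `*` chart_dom B p.2)
    (fun p q => (chart_map A p.1 q.1, chart_map B p.2 q.2))
    (fun p x => (chart_inv A p.1 x.1, chart_inv B p.2 x.2)).

Definition coboundary {R : realType} {M : Type} (f : M -> M)
    (gamma mu : M -> circle R) : Prop :=
  forall p, gamma p = mu (f p) - mu p.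

Definition skew_product {R : realType} {M : Type} (f : M -> M)
    (gamma : M -> circle R) (q : M * circle R) : M * circle R :=
  (f q.1, q.2 + gamma q.1).

Section CircleBundle.
Context {R : realType} {M S : topologicalType}.
Local Notation plane := 'rV[R]_2.
Local Notation N := (M * circle R)%type.
Local Notation space := (plane * R^o)%type.
Variable A : atlas plane M.
Local Notation AN := (prod_atlas A (circle_atlas R)).

(* the line bundle T S^1 *)
Definition vertical (q : N) : {vspace space} :=
  limg (linfun (tmap (circle_atlas R) AN (fun t => (q.1, t)) q.2)).

Definition plane_subbundle (xi : N -> {vspace space}) : Prop :=
  (forall q, \dim (xi q) = 2%N) /\
  (forall q, exists (U : set N) (X Y : N -> space),
     [/\ open U /\ U q,
         continuous_vector_field_on AN U X,
         continuous_vector_field_on AN U Y &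
         forall z, U z -> xi z = (<[X z]> + <[Y z]>)%VS]).

Definition invariant_subbundle (F : N -> N) (xi : N -> {vspace space}) : Prop :=
  forall q, (linfun (tmap AN AN F q) @: xi q)%VS = xi (F q).

(* A hypersurface of [N] is the image of an embedding [i : S -> N]. *)
Variable B : atlas plane S.

Definition C1_embedding (i : S -> N) : Prop :=
  [/\ Ck_map B AN 1 i,
      (forall s, injective (tmap B AN i s)),
      injective i &
      (forall U : set S, open U ->
         exists2 V : set N, open V & i @^-1` V = U)].

Definition tangent_plane (i : S -> N) (s : S) : {vspace space} :=
  limg (linfun (tmap B AN i s)).

Definition transversal_hypersurface (i : S -> N) : Prop :=
  forall s, (tangent_plane i s + vertical (i s))%VS = fullv.

(* [X s] generates the line xi /\ TS where xi and TS are transversal, and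
   vanishes exactly at the singular points. *)
Definition represents_characteristic_foliation
    (xi : N -> {vspace space}) (i : S -> N) (X : S -> plane) : Prop :=
  continuous_vector_field_on B setT X /\
  forall s,
    if xi (i s) == tangent_plane i s then X s = 0
    else <[tmap B AN i s (X s)]>%VS = (xi (i s) :&: tangent_plane i s)%VS.

Definition induced_form (w : M -> plane -> plane -> R) (i : S -> N)
    (s : S) (u v : plane) : R :=
  w (i s).1 (tmap B A (fst \o i) s u) (tmap B A (fst \o i) s v).

End CircleBundle.

(* Main.v *)
(* The plane field at [(p, t)] is the graph of the differential of [mu] at [p].
   Differentiating [mu o f = mu + gamma] shows that the skew product preserves
   it.  Let [i : S -> M x S^1] parametrize a transversal hypersurface and put
   [nu := snd o i - mu o fst o i].  A tangent vector of [S] is mapped into the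
   plane field exactly when [d nu] kills it, and transversality makes the form
   induced on [S] symplectic, so the field [X] defined by
   [omega(X, .) = d nu] spans the characteristic foliation.  It is hamiltonian
   wherever the circle-valued map [nu] lifts to the reals. *)

From HB Require Import structures.
Require Import Defs.
From mathcomp Require Import all_boot all_order all_algebra.
From mathcomp Require Import all_classical all_reals all_analysis.
From mathcomp Require Import ring lra.

Set Implicit Arguments.
Unset Strict Implicit.
Unset Printing Implicit Defensive.

Import Order.TTheory GRing.Theory Num.Theory.
Import numFieldNormedType.Exports.

Local Open Scope classical_set_scope.
Local Open Scope ring_scope.

(** * Circle charts *)

Section Circle.
Variable R : realType.
Local Notation C := (circle_atlas R).
Local Notation pic := (\pi_(circle R))%qT.
Implicit Types (x : R) (y c : circle R).

(** Two conventions shape the proof. The charts of the circle go through arbitrary representatives,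
    so an identity in R/Z, once lifted, holds between reals up to an integer; where the lifts are
    continuous this integer is locally constant and the differential ignores it. Moreover, a tangent
    vector at [z] is written in the chart attached to [z], and these charts vary with [z] without
    any continuity; continuity of a field is therefore proved by rewriting it in one fixed chart.
    Since [mu] is only C^1, the plane field and the characteristic field are in general merely
    continuous. In dimension two [omega] is a multiple of the determinant: the equation for [X] is
    solved by an explicit formula with continuous ingredients, [X] lies in the kernel of [d nu]
    because [omega(X, X) = 0], and where [X] is nonzero this kernel is a line. For invariance, the
    differentiated equation gives one inclusion and surjectivity of [D f] the other. *)

Lemma circle_eqP x x' : (pic x = pic x') <-> (x - x' \is a Num.int).
Proof.
have E := @Quotient.idealrBE _ (integers R) x x'.
split=> [h|h].
  have /eqP h' : (\pi_({ideal_quot integers R}) x = \pi_({ideal_quot integers R}) x')%qT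
    by exact: h.
  by rewrite -E in h'.
have : x - x' \in integers R by exact: h.
by rewrite E => /eqP.
Qed.

Lemma circle_piD x x' : pic (x + x') = pic x + pic x'.
Proof. exact: (raddfD (\pi_({ideal_quot integers R}))%qT). Qed.

Lemma circle_chart_invK c y : pic (chart_map C c y) = y.
Proof.
rewrite -[RHS]reprK; apply/circle_eqP => /=.
set s := repr y - repr c + 2^-1.
rewrite (_ : _ - _ - repr y = - (Num.floor s)%:~R); last by rewrite /s; ring.
by rewrite rpredN intr_int.
Qed.

Lemma circle_chart_dom_center c : chart_dom C c c.
Proof.
apply/eqP => /= h.
have : pic (repr c) = pic (repr c + 2^-1) by rewrite circle_piD reprK.
move=> /circle_eqP /intrP[m]; rewrite opprD addrA subrr add0r => mE.
have [h0|h0] := lerP 0 m.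
  by (have : (0 : R) <= m%:~R by rewrite ler0z); lra.
have : (m%:~R : R) <= (-1)%:~R by rewrite ler_int -ltzD1.
by lra.
Qed.

(** The chart picks the representative in the half-open interval of length one centred at [repr c].
    Only the antipode of [c] is sent to the left endpoint, and the domain excludes it, whence the
    strict inequality. *)
Lemma circle_chart_bound c y : chart_dom C c y ->
  `|(chart_map C c y : R) - repr c| < 2^-1 :> R.
Proof.
move=> /eqP /= h; set s := repr y - repr c + 2^-1.
have /andP[s0 s1] := Num.Theory.floor_itv s.
have sint : s != (Num.floor s)%:~R :> R.
  apply/eqP => sE; apply: h; rewrite -[y]reprK -[c]reprK -circle_piD.
  apply/circle_eqP; rewrite (_ : _ - _ = s - 1); last by rewrite /s; field.
  by rewrite sE rpredB ?intr_int ?rpred1.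
rewrite intrD in s1.
by rewrite ltr_norml; apply/andP; split; lra.
Qed.

Lemma circle_chart_pi c x : `|x - repr c| < 2^-1 :> R ->
  chart_map C c (pic x) = x :> R.
Proof.
rewrite ltr_norml => /andP[h0 h1] /=.
have /circle_eqP/intrP[m mE] : pic (repr (pic x)) = pic x by rewrite reprK.
(* [m] is the integer by which the chosen representative exceeds [x]; it is the floor because
   [x - repr c + 2^-1] lies strictly between 0 and 1. *)
rewrite (_ : Num.floor _ = m); first by lra.
by apply: Num.Theory.floor_def; rewrite intrD; apply/andP; split; lra.
Qed.

Lemma circle_dom_pi c x : `|x - repr c| < 2^-1 :> R -> chart_dom C c (pic x).
Proof.
rewrite ltr_norml => /andP[h0 h1] /=; apply/eqP => /=.
rewrite -{1}[c]reprK -circle_piD => /circle_eqP /intrP[m mE].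
have [m0|m0] := lerP 0 m.
  by (have : (0 : R) <= m%:~R by rewrite ler0z); lra.
have : (m%:~R : R) <= (-1)%:~R by rewrite ler_int -ltzD1.
by lra.
Qed.

Lemma circle_pi_continuous : continuous (pic : R -> circle R).
Proof. exact: pi_continuous. Qed.

(** The saturation of an open set is the union of its integer translates, hence open. Openness of
    the projection is what makes the charts continuous and their domains open. *)
Lemma circle_pi_nbhs x (U : set R) : nbhs x U -> nbhs (pic x) (pic @` U).
Proof.
rewrite !nbhsE => -[V [oV Vx] VU]; exists (pic @` V); last exact: image_subset.
split; last by exists x.
rewrite /open/= /quotient_open.
rewrite (_ : _ @^-1` _ = \bigcup_(m : int) (fun x : R => x + m%:~R) @^-1` V).
  apply: bigcup_open => m _; apply: open_comp oV => z _.
  by apply: cvgD; [exact: cvg_id|exact: cvg_cst].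
apply/seteqP; split=> [z /= [v Vv /circle_eqP/intrP[m mE]]|z /= [m _ Vm]].
  by exists m => //=; rewrite -mE addrC subrK.
exists (z + m%:~R) => //; apply/circle_eqP.
by rewrite addrAC subrr add0r intr_int.
Qed.

Lemma circle_chart_image c y : chart_dom C c y ->
  nbhs (chart_map C c y : R) [set x | `|x - repr c| < 2^-1].
Proof.
move=> /circle_chart_bound b.
have : continuous (fun x : R => `|x - repr c|).
  by move=> z; apply: cvg_norm; apply: cvgB; [exact: cvg_id|exact: cvg_cst].
by move=> /(_ (chart_map C c y : R) [set x | x < 2^-1]); apply; exact: lt_nbhsl.
Qed.

Lemma circle_chart_continuous c y : chart_dom C c y ->
  {for y, continuous (chart_map C c : _ -> R)}.
Proof.
move=> cy U /= Uy.
pose V : set R := U `&` [set x | `|x - repr c| < 2^-1].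
have : nbhs (chart_map C c y : R) V.
  by apply: filterI => //; exact: circle_chart_image.
move=> /circle_pi_nbhs; rewrite circle_chart_invK; apply: filterS.
by move=> _ [x [Ux bx] <-]; rewrite -(circle_chart_pi bx) in Ux.
Qed.

Lemma circle_dom_open c : open (chart_dom C c).
Proof.
rewrite openE => y cy; rewrite /interior -(circle_chart_invK c y).
have := circle_chart_image cy.
by move=> /circle_pi_nbhs; apply: filterS => _ [x /= bx <-]; exact: circle_dom_pi.
Qed.

(* Two lifts differ by a continuous integer-valued function. *)
Lemma circle_lift_unique (T : topologicalType) (g h : T -> R) (a : T) :
  {for a, continuous g} -> {for a, continuous h} ->
  (forall t, pic (g t) = pic (h t)) ->
  \forall t \near a, g t = h t + (g a - h a).
Proof.
move=> gc hc gh.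
have dc : `|(g t - h t) - (g a - h a)| @[t --> a] --> (0 : R).
  rewrite -[X in _ --> X](normr0 R) -(subrr (g a - h a)).
  by apply: cvg_norm; apply: cvgB; [exact: cvgB|exact: cvg_cst].
have : \forall t \near a, `|(g t - h t) - (g a - h a)| < 1.
  exact: (cvgr_lt _ dc).
apply: filterS => t d1.
have /circle_eqP/intrP[m mE] := gh t; have /circle_eqP/intrP[n nE] := gh a.
move: d1; rewrite mE nE -intrB -intr_norm.
rewrite -[1]/(1%:~R) ltr_int => d1.
have /eqP mn : m == n by rewrite -subr_eq0 -normr_eq0 eq_le normr_ge0 -ltzD1 d1.
by rewrite -mn -mE addrC subrK.
Qed.

End Circle.

(** * C^1 maps between normed spaces *)

Lemma continuous_near (T U : topologicalType) (f g : T -> U) (z : T) :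
  (\forall y \near z, f y = g y) -> {for z, continuous f} ->
  {for z, continuous g}.
Proof.
move=> fg fc; rewrite /prop_for /continuous_at -(nbhs_singleton fg).
exact: cvg_trans (near_eq_cvg fg) fc.
Qed.

Section ContinuouslyDifferentiable.
Context {R : realType}.
Implicit Types V W : normedModType R.

(** The first-order expansion only sees the germ at [x], and the differential is determined by
    it. *)
Lemma is_diff_near V W (f g : V -> W) (x : V) :
  (\forall y \near x, f y = g y) -> differentiable f x ->
  is_diff x g ('d f x).
Proof.
move=> fg df; have fgx : f x = g x := nbhs_singleton fg.
have [dfc /eqaddoP dfE] : continuous ('d f x) /\
  (f \o shift x = cst (f x) + 'd f x +o_ 0 id) by apply/diff_locallyP.
have dgE : g \o shift x = cst (g x) + 'd f x +o_ 0 id.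
  have fg0 : \forall h \near (0 : V), f (h + x) = g (h + x).
    by move: fg; rewrite (near_shift 0) => /=; apply: filterS => h /=; rewrite subr0.
  apply/eqaddoP => _/posnumP[e]; near=> h.
  rewrite (_ : (g \o shift x - _) h = (f \o shift x - (cst (f x) + 'd f x)) h).
    by near: h; exact: dfE.
  by rewrite !fctE /= fgx (near fg0 h).
have E : 'd g x = 'd f x :> (V -> W) by exact: diff_unique.
by split; [apply/diff_locallyP; split; rewrite E | exact: E].
Unshelve. all: by end_near. Qed.

(** Meant for circle-valued maps: two real lifts differ by a constant near a point and so share
    their differential. *)
Lemma is_diff_near_cst V W (f g : V -> W)
    (x : V) (c : W) :
  (\forall y \near x, f y = g y + c) -> differentiable g x ->
  is_diff x f ('d g x).
Proof.
move=> fg dg; have dgc : is_diff x (g + cst c) ('d g x).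
  apply: DiffDef; first exact: differentiableD.
  apply: (eq_trans (diffD dg (differentiable_cst c x))).
  apply/funext => v; rewrite -[RHS]addr0; congr (_ + _).
  exact: (congr1 (@^~ v) (diff_cst c x)).
rewrite -(diff_val (is_diff_def := dgc)); apply: is_diff_near ex_diff.
by apply: filterS fg => y ->.
Qed.

(** Pointwise counterpart of [Ck_on 1]: continuity is asked of each directional derivative, not of
    the differential in operator norm. The two agree in finite dimension, which is why the
    composition lemma takes a row space as the intermediate space. *)
Definition C1_at V W (f : V -> W) (x : V) : Prop :=
  (\forall y \near x, differentiable f y) /\
  forall v, {for x, continuous (fun y => 'd f y v)}.

Lemma C1_at_diff V W (f : V -> W) x : C1_at f x -> differentiable f x.
Proof. by case=> /nbhs_singleton. Qed.

Lemma Ck_on_C1_at V W k (U : set V) (f : V -> W) x :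
  (0 < k)%N -> Ck_on k U f -> nbhs x U -> C1_at f x.
Proof.
case: k => // k _ [df cdf] Ux; split; first exact: filterS Ux.
move=> v; have Ux' := nbhs_singleton Ux.
case: k cdf => [|k] /(_ v) cdf; first exact: cdf.
by apply: differentiable_continuous; apply: cdf.1.
Qed.

Lemma C1_at_Ck_on V W (U : set V) (f : V -> W) :
  (forall x, U x -> C1_at f x) -> Ck_on 1 U f.
Proof.
by move=> h; split=> [x /h/C1_at_diff//|v x /h[_]]; exact.
Qed.

Lemma C1_at_is_diff V W (f : V -> W) (D : V -> V -> W) x :
  (\forall y \near x, is_diff y f (D y)) ->
  (forall v, {for x, continuous (D^~ v)}) -> C1_at f x.
Proof.
move=> df cD; split=> [|v]; first by apply: filterS df => y [].
have [_ E] := nbhs_singleton df.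
rewrite /prop_for /continuous_at /= E.
apply: cvg_trans (cD v); apply: near_eq_cvg.
by apply: filterS df => y [_ ->].
Qed.

Lemma C1_at_near V W (f g : V -> W) x :
  (\forall y \near x, f y = g y) -> C1_at f x -> C1_at g x.
Proof.
move=> fg [df cdf]; have [nfg ndf] := (near_join fg, near_join df).
have dfg : \forall y \near x, is_diff y g ('d f y).
  by near=> y; apply: is_diff_near; near: y.
split=> [|v]; first by apply: filterS dfg => y [].
have := cdf v; rewrite /prop_for /= => cdv.
rewrite /continuous_at (diff_val (is_diff_def := nbhs_singleton dfg)).
apply: cvg_trans cdv; apply: near_eq_cvg.
by apply: filterS dfg => y [_ ->].
Unshelve. all: by end_near. Qed.

Lemma C1_atB V W (f g : V -> W) x :
  C1_at f x -> C1_at g x -> C1_at (fun y => f y - g y) x.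
Proof.
move=> [df cdf] [dg cdg].
have dfg : \forall y \near x, is_diff y (fun y => f y - g y) ('d f y \- 'd g y).
  near=> y; have dfy : differentiable f y by near: y.
  have dgy : differentiable g y by near: y.
  apply: DiffDef; first exact: differentiableB.
  exact: diffB.
by apply: C1_at_is_diff dfg _ => v; exact: cvgB (cdf v) (cdg v).
Unshelve. all: by end_near. Qed.

Lemma diff_row_sum W n (g : 'rV[R]_n -> W) (y u : 'rV[R]_n) :
  'd g y u = \sum_k u 0 k *: 'd g y (delta_mx 0 k).
Proof.
rewrite {1}[u]row_sum_delta linear_sum; apply: eq_bigr => k _.
by rewrite linearZ.
Qed.

(** Continuity of the derivative is given for fixed directions only; expanding the moving vector
    [u s] in the canonical basis leaves finitely many of these. *)
Lemma cvg_diff_row W n (T : topologicalType) (g : 'rV[R]_n -> W) (t : T)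
    (h u : T -> 'rV[R]_n) :
  C1_at g (h t) -> {for t, continuous h} -> {for t, continuous u} ->
  {for t, continuous (fun s => 'd g (h s) (u s))}.
Proof.
move=> [_ cdg] ch cu.
rewrite (_ : (fun s => _) = fun s => \sum_k u s 0 k *: 'd g (h s) (delta_mx 0 k));
  last by apply/funext => s; exact: diff_row_sum.
rewrite /prop_for /continuous_at.
apply: cvg_big => [|k _]; first exact: add_continuous.
apply: cvgZ.
  by apply: (@continuous_comp _ _ _ u (fun M : 'rV[R]_n => M 0 k)) => //;
    exact: coord_continuous.
apply: (@continuous_comp _ _ _ h (fun y => 'd g y (delta_mx 0 k))) => //.

Qed.

Lemma C1_at_comp V W n (f : V -> 'rV[R]_n) (g : 'rV[R]_n -> W) x :
  C1_at f x -> C1_at g (f x) -> C1_at (g \o f) x.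
Proof.
move=> [df cdf] Cg; have [dg _] := Cg.
have cf : {for x, continuous f}.
  exact: (differentiable_continuous (nbhs_singleton df)).
have {}dg : \forall y \near x, differentiable g (f y) := cf _ dg.
have dgf : \forall y \near x, is_diff y (g \o f) ('d g (f y) \o 'd f y).
  near=> y; have dfy : differentiable f y by near: y.
  have dgy : differentiable g (f y) by near: y.
  apply: DiffDef; first exact: differentiable_comp.
  exact: diff_comp.
by apply: C1_at_is_diff dgf _ => v; exact: cvg_diff_row Cg cf (cdf v).
Unshelve. all: by end_near. Qed.

Lemma is_diff_proj1 V W (x : V * W) : is_diff x (fst : V * W -> V) fst.
Proof.
have cfst : continuous (fst : V * W -> V) by move=> ?; exact: cvg_fst.
by split; [exact: (@linear_differentiable R (V * W)%type V fst)
          |exact: (@diff_lin R (V * W)%type V fst)].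
Qed.

Lemma is_diff_proj2 V W (x : V * W) : is_diff x (snd : V * W -> W) snd.
Proof.
have csnd : continuous (snd : V * W -> W) by move=> ?; exact: cvg_snd.
by split; [exact: (@linear_differentiable R (V * W)%type W snd)
          |exact: (@diff_lin R (V * W)%type W snd)].
Qed.

Lemma is_diff_fst V W W' (f : V -> W * W') x : differentiable f x ->
  is_diff x (fst \o f) (fst \o 'd f x).
Proof.
by move=> /differentiableP df; exact: is_diff_comp df (is_diff_proj1 (f x)).
Qed.

Lemma is_diff_snd V W W' (f : V -> W * W') x : differentiable f x ->
  is_diff x (snd \o f) (snd \o 'd f x).
Proof.
by move=> /differentiableP df; exact: is_diff_comp df (is_diff_proj2 (f x)).
Qed.

Lemma C1_at_fst V W W' (f : V -> W * W') x : C1_at f x -> C1_at (fst \o f) x.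
Proof.
move=> [df cdf].
have dff : \forall y \near x, is_diff y (fst \o f) (fst \o 'd f y).
  by apply: filterS df => y; exact: is_diff_fst.
apply: C1_at_is_diff dff _ => v.
by apply: continuous_comp (cdf v) _; exact: cvg_fst.
Qed.

Lemma C1_at_snd V W W' (f : V -> W * W') x : C1_at f x -> C1_at (snd \o f) x.
Proof.
move=> [df cdf].
have dff : \forall y \near x, is_diff y (snd \o f) (snd \o 'd f y).
  by apply: filterS df => y; exact: is_diff_snd.
apply: C1_at_is_diff dff _ => v.
by apply: continuous_comp (cdf v) _; exact: cvg_snd.
Qed.

End ContinuouslyDifferentiable.

(** * Calculus in charts *)

Section Charts.
Context {R : realType} {E : normedModType R} {T : topologicalType}.
Variable A : atlas E T.
Hypothesis mA : is_manifold A.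
Local Notation dom := (chart_dom A).
Local Notation cm := (chart_map A).
Local Notation ci := (chart_inv A).

Lemma chart_dom_self p : dom p p.
Proof. by have [_ _ /(_ p)[]] := mA. Qed.

Lemma chart_dom_open p : open (dom p).
Proof. by have [_ _ /(_ p)[]] := mA. Qed.

Lemma chart_mapK p z : dom p z -> ci p (cm p z) = z.
Proof. by have [_ _ _ + _] := mA; exact. Qed.

Lemma chart_map_continuous p z : dom p z -> {for z, continuous (cm p)}.
Proof.
have [_ _ /(_ p)[_ od _ + _] _ _ pz] := mA.
by rewrite continuous_open_subspace// => /(_ z); apply; rewrite inE.
Qed.

Lemma chart_codom_nbhs p z : dom p z -> nbhs (cm p z) (chart_codom A p).
Proof.
have [_ _ /(_ p)[_ _ oc _ _] _ _ pz] := mA.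
by apply: open_nbhs_nbhs; split => //; exists z.
Qed.

Lemma chart_inv_continuous p z : dom p z -> {for cm p z, continuous (ci p)}.
Proof.
have [_ _ /(_ p)[_ _ oc _ +] _ _ pz] := mA.
rewrite continuous_open_subspace// => /(_ (cm p z)); apply; rewrite inE.
by exists z.
Qed.

Lemma chart_inv_cvg p z : dom p z -> ci p x @[x --> cm p z] --> z.
Proof.
move=> pz; have := chart_inv_continuous pz.
by rewrite /prop_for /continuous_at chart_mapK.
Qed.

Lemma chart_inv_near p z (P : set T) : dom p z -> (\forall y \near z, P y) ->
  \forall x \near cm p z, P (ci p x).
Proof. by move=> pz Pz; exact: (chart_inv_cvg pz Pz). Qed.

Lemma chart_invK_near p z : dom p z -> \forall x \near cm p z, cm p (ci p x) = x.
Proof.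
move=> /chart_codom_nbhs; apply: filterS => _ [y py <-].
by rewrite chart_mapK.
Qed.

Lemma chart_transition_C1 p q z : dom p z -> dom q z ->
  C1_at (cm q \o ci p) (cm p z).
Proof.
move=> pz qz; have [_ _ _ _ /(_ p q 1%N) h] := mA.
apply: Ck_on_C1_at h _ => //.
have : \forall x \near cm p z, (dom p `&` dom q) (ci p x).
  apply: chart_inv_near => //.
  by apply: filterI; apply: open_nbhs_nbhs; split=> //; exact: chart_dom_open.
move=> h; near=> x; exists (ci p x); first by near: x.
by near: x; exact: chart_invK_near.
Unshelve. all: by end_near. Qed.

End Charts.

Section ChartCalculus.
Context {R : realType} {E E' : normedModType R} {T T' : topologicalType}.
Variables (A : atlas E T) (B : atlas E' T').
Hypothesis mA : is_manifold A.

Lemma Ck_map_C1_at k (h : T -> T') p q z : (0 < k)%N -> Ck_map A B k h ->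
  chart_dom A p z -> open (chart_dom B q) -> chart_dom B q (h z) ->
  C1_at (chart_map B q \o h \o chart_inv A p) (chart_map A p z).
Proof.
move=> k0 [hc /(_ p q) hk] pz oq qz; apply: Ck_on_C1_at hk _ => //.
have : \forall x \near chart_map A p z,
    (chart_dom A p `&` h @^-1` chart_dom B q) (chart_inv A p x).
  apply: (chart_inv_near mA) => //; apply: filterI.
    by apply: open_nbhs_nbhs; split=> //; exact: chart_dom_open.
  exact: (hc z I _ (open_nbhs_nbhs (conj oq qz))).
move=> H; near=> x; exists (chart_inv A p x); last first.
  by near: x; exact: (chart_invK_near mA).
by split; [split => //|]; near: x; apply: filterS H => x [].
Unshelve. all: by end_near. Qed.

Hypothesis mB : is_manifold B.
Variables (W : normedModType R) (h : T -> T') (phi : T' -> W).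
Variables (p z : T) (q : T').
Hypotheses (pz : chart_dom A p z) (qz : chart_dom B q (h z)).
Hypothesis hc : {for z, continuous h}.

Lemma rep_near : \forall x \near chart_map A p z,
  ((phi \o chart_inv B q) \o (chart_map B q \o h \o chart_inv A p)) x =
  (phi \o h \o chart_inv A p) x.
Proof.
have : \forall x \near chart_map A p z, chart_dom B q (h (chart_inv A p x)).
  apply: (chart_inv_near mA (P := fun y => chart_dom B q (h y))) => //.
  exact: (hc (open_nbhs_nbhs (conj (chart_dom_open mB q) qz))).
by apply: filterS => x /(chart_mapK mB) /= ->.
Qed.

Lemma rep_center : (chart_map B q \o h \o chart_inv A p) (chart_map A p z) =
  chart_map B q (h z).
Proof. by rewrite /= (chart_mapK mA). Qed.

(** Chain rule through an intermediate manifold. The chart at [q] and its inverse cancel only where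
    [h] stays in the chart domain, so the composite is compared with its germ. *)
Lemma is_diff_rep :
  differentiable (chart_map B q \o h \o chart_inv A p) (chart_map A p z) ->
  differentiable (phi \o chart_inv B q) (chart_map B q (h z)) ->
  is_diff (chart_map A p z) (phi \o h \o chart_inv A p)
    ('d (phi \o chart_inv B q) (chart_map B q (h z)) \o
     'd (chart_map B q \o h \o chart_inv A p) (chart_map A p z)).
Proof.
rewrite -rep_center => dh dphi.
have [dr rE] := is_diff_near rep_near (differentiable_comp dh dphi).
by split=> //; rewrite rE diff_comp.
Qed.

End ChartCalculus.

Section C1Rep.
Context {R : realType} {E : normedModType R} {n : nat} {T T' : topologicalType}.
Variables (A : atlas E T) (B : atlas 'rV[R]_n T').
Hypothesis mA : is_manifold A.
Hypothesis mB : is_manifold B.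

Lemma C1_at_rep (W : normedModType R) (h : T -> T') (phi : T' -> W) p z q :
  chart_dom A p z -> chart_dom B q (h z) -> {for z, continuous h} ->
  C1_at (chart_map B q \o h \o chart_inv A p) (chart_map A p z) ->
  C1_at (phi \o chart_inv B q) (chart_map B q (h z)) ->
  C1_at (phi \o h \o chart_inv A p) (chart_map A p z).
Proof.
move=> pz qz hc Ch; rewrite -(rep_center B mA h q pz) => Cphi.
exact: (C1_at_near (rep_near mA mB phi pz qz hc) (C1_at_comp Ch Cphi)).
Qed.

End C1Rep.

(** * Changes of charts as isomorphisms of tangent spaces *)

Section ChartChange.
Context {R : realType} {E : normedModType R} {T : topologicalType}.
Variable A : atlas E T.
Hypothesis mA : is_manifold A.

(** A change of charts is the identity map seen in two charts, so this is the chain rule with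
    [h := id]. *)
Lemma is_diff_chart_change (W : normedModType R) (phi : T -> W) p q z :
  chart_dom A p z -> chart_dom A q z ->
  differentiable (phi \o chart_inv A q) (chart_map A q z) ->
  is_diff (chart_map A p z) (phi \o chart_inv A p)
    ('d (phi \o chart_inv A q) (chart_map A q z) \o chart_change A p q z).
Proof.
move=> pz qz dphi; apply: (is_diff_rep mA mA (h := id)) => //.
by have /C1_at_diff := chart_transition_C1 mA pz qz.
Qed.

Lemma chart_changeK p q z u : chart_dom A p z -> chart_dom A q z ->
  chart_change A q p z (chart_change A p q z u) = u.
Proof.
move=> pz qz; have /C1_at_diff dt := chart_transition_C1 mA qz pz.
have [_ /(congr1 (@^~ u)) /= <-] := is_diff_chart_change pz qz dt.
have : \forall x \near chart_map A p z, id x = (chart_map A p \o chart_inv A p) x.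
  by apply: filterS (chart_invK_near mA pz) => x /= ->.
by move=> /is_diff_near [] => [|_ ->]; rewrite ?diff_val.
Qed.

Lemma chart_change_comp p q r z u :
  chart_dom A p z -> chart_dom A q z -> chart_dom A r z ->
  chart_change A q r z (chart_change A p q z u) = chart_change A p r z u.
Proof.
move=> pz qz rz; have /C1_at_diff dt := chart_transition_C1 mA qz rz.
by have [_ /(congr1 (@^~ u)) /= <-] := is_diff_chart_change pz qz dt.
Qed.

Lemma chart_change_id p z u : chart_dom A p z -> chart_change A p p z u = u.
Proof.
by move=> pz; rewrite -[LHS](chart_change_comp u pz pz pz); exact: chart_changeK.
Qed.

End ChartChange.

(** * Symplectic linear algebra in the plane *)

Section PlaneForms.
Variable R : realType.
Local Notation plane := 'rV[R]_2.
Implicit Types (w : plane -> plane -> R) (a : plane -> R) (u v x : plane).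

Local Notation e0 := (delta_mx 0 0 : plane).
Local Notation e1 := (delta_mx 0 1 : plane).

Lemma plane_basis u : u = u 0 0 *: e0 + u 0 1 *: e1.
Proof.
rewrite [LHS]row_sum_delta !big_ord_recl big_ord0 addr0.
by congr (_ + _ *: delta_mx _ _); [congr (u _ _)|]; apply/val_inj.
Qed.

Definition alternating_bilinear w := bilinear_form w /\ forall u, w u u = 0.

(** Alternating forms on a plane are multiples of the determinant; the single coefficient [w e0 e1]
    then governs both nondegeneracy and continuity. *)
Lemma alternating_planeE w u v : alternating_bilinear w ->
  w u v = w e0 e1 * (u 0 0 * v 0 1 - u 0 1 * v 0 0).
Proof.
move=> [[wr wl] walt].
have wD1 b x y z : w (b *: x + y) z = b * w x z + w y z by exact: (wl z b x y).
have wD2 b x y z : w z (b *: x + y) = b * w z x + w z y by exact: (wr z b x y).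
have w0l z : w 0 z = 0 by have := wD1 (-1) 0 0 z; rewrite scaler0 addr0; lra.
have w0r z : w z 0 = 0 by have := wD2 (-1) 0 0 z; rewrite scaler0 addr0; lra.
have wZ1 b x z : w (b *: x) z = b * w x z.
  by have := wD1 b x 0 z; rewrite addr0 w0l addr0.
have wZ2 b x z : w z (b *: x) = b * w z x.
  by have := wD2 b x 0 z; rewrite addr0 w0r addr0.
have w10 : w e1 e0 = - w e0 e1.
  by have := walt (1 *: e0 + e1); rewrite wD1 !wD2 !walt; lra.
rewrite [u in LHS]plane_basis [v in LHS]plane_basis wD1 wZ1 !wD2 !wZ2 !walt w10.
by ring.
Qed.

Lemma symplectic_planeP w : symplectic_form w <->
  alternating_bilinear w /\ w e0 e1 != 0.
Proof.
split=> [[bw aw nw]|[[bw aw] w0]].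
  split=> //; apply/eqP => w0; have : e0 = 0.
    by apply: nw => v; rewrite (alternating_planeE _ _ (conj bw aw)) w0 mul0r.
  by move/rowP/(_ 0)/eqP; rewrite !mxE !eqxx oner_eq0.
split=> // u uw; have E v := alternating_planeE u v (conj bw aw).
have u1 : u 0 1 = 0.
  by move: (E e0); rewrite uw !mxE /= => /eqP; rewrite eq_sym mulf_eq0 (negbTE w0) /=;
    move/eqP; lra.
have u0 : u 0 0 = 0.
  by move: (E e1); rewrite uw !mxE /= => /eqP; rewrite eq_sym mulf_eq0 (negbTE w0) /=;
    move/eqP; lra.
by rewrite (plane_basis u) u0 u1 !scale0r addr0.
Qed.

(** The solution [x] of [w x v = a v], found by testing the determinant formula on [e0] and [e1].
    The explicit form is what later gives continuity. *)
Definition sharp w a : plane := (w e0 e1)^-1 *: (a e1 *: e0 - a e0 *: e1).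

Lemma sharpE w a v : symplectic_form w -> scalar a -> w (sharp w a) v = a v.
Proof.
move=> /symplectic_planeP[aw w0] la.
have aE : a v = v 0 0 * a e0 + v 0 1 * a e1.
  have a0 : a 0 = 0 by have := la (-1) 0 0; rewrite scaler0 addr0 /=; lra.
  have aZ b x : a (b *: x) = b * a x.
    by have := la b x 0; rewrite !addr0 a0 addr0.
  by rewrite {1}(plane_basis v) la aZ.
rewrite alternating_planeE// aE !mxE /=.
by field.
Qed.

Lemma symplectic_inj w x y : symplectic_form w ->
  (forall v, w x v = w y v) -> x = y.
Proof.
move=> [[_ wl] _ nw] xy; apply/subr0_eq; apply: nw => v.
have /= := wl v (-1) y x; rewrite scaleN1r [- y + x]addrC => ->.
by rewrite xy /= mulN1r addNr.
Qed.

Lemma linear_planeE (V : lmodType R) (g : {linear plane -> V}) u :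
  g u = u 0 0 *: g (delta_mx 0 0) + u 0 1 *: g (delta_mx 0 1).
Proof. by rewrite {1}(plane_basis u) linearD !linearZ. Qed.

(** If the coefficient of the pullback vanished, so would the whole pullback; but surjectivity lets
    it take the nonzero value of [w] on the basis. *)
Lemma symplectic_pullback (w : plane -> plane -> R) (L : {linear plane -> plane}) :
  symplectic_form w -> (forall u, exists v, L v = u) ->
  symplectic_form (fun u v => w (L u) (L v)).
Proof.
move=> [[wr wl] aw nw] surjL.
have ba : alternating_bilinear (fun u v => w (L u) (L v)).
  split=> [|u]; last exact: aw.
  by split=> u b x y /=; rewrite linearP; [exact: wr|exact: wl].
apply/symplectic_planeP; split=> //; apply/eqP => c0.
have /symplectic_planeP[_ /eqP] : symplectic_form w by [].
have [x xE] := surjL (delta_mx 0 0); have [y yE] := surjL (delta_mx 0 1).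
by apply; have := alternating_planeE x y ba; rewrite xE yE c0 mul0r.
Qed.

Lemma plane_collinear (x v : plane) : x != 0 ->
  x 0 0 * v 0 1 - x 0 1 * v 0 0 = 0 -> exists k, v = k *: x.
Proof.
move=> x0 /eqP; rewrite subr_eq0 => /eqP xv.
have plane_eq (u u' : plane) : u 0 0 = u' 0 0 -> u 0 1 = u' 0 1 -> u = u'.
  by move=> h0 h1; rewrite (plane_basis u) (plane_basis u') h0 h1.
have [x00|x00] := eqVneq (x 0 0) 0; last first.
  exists (v 0 0 / x 0 0); apply: plane_eq; rewrite mxE; first by rewrite divfK.
  by apply: (mulfI x00); rewrite xv; field.
have x01 : x 0 1 != 0.
  by apply: contra_neq x0 => x01; apply: plane_eq; rewrite ?x00 ?x01 mxE.
exists (v 0 1 / x 0 1); apply: plane_eq; rewrite mxE; last by rewrite divfK.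
by apply: (mulfI x01); rewrite -xv x00; ring.
Qed.

Lemma cvg_sharp (T : topologicalType) (t : T) (c h0 h1 : T -> R) :
  {for t, continuous c} -> {for t, continuous h0} -> {for t, continuous h1} ->
  c t != 0 ->
  {for t, continuous (fun s => (c s)^-1 *:
    (h1 s *: (delta_mx 0 0 : plane) - h0 s *: (delta_mx 0 1 : plane)))}.
Proof.
move=> cc ch0 ch1 ct; apply: cvgZ; first exact: cvgV.
by apply: cvgB; apply: cvgZr_tmp.
Qed.

End PlaneForms.

(** * Tangent maps into the circle bundle *)

Section TangentMaps.
Context {R : realType} {E E' : normedModType R} {T T' : topologicalType}.
Variables (A : atlas E T) (B : atlas E' T').
Hypothesis mA : is_manifold A.
Local Notation C := (circle_atlas R).

Lemma circle_map_near (mu : T -> circle R) (z : T) c c' :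
  {for z, continuous mu} -> chart_dom C c (mu z) -> chart_dom C c' (mu z) ->
  exists k : R^o, \forall y \near z,
    chart_map C c (mu y) = chart_map C c' (mu y) + k.
Proof.
move=> mc cz c'z; eexists.
apply: (circle_lift_unique (g := chart_map C c \o mu) (h := chart_map C c' \o mu)).
- exact: continuous_comp mc (circle_chart_continuous cz).
- exact: continuous_comp mc (circle_chart_continuous c'z).
- by move=> t; rewrite !circle_chart_invK.
Qed.

Lemma Ck_map_circle_C1_at k (mu : T -> circle R) p z c :
  (0 < k)%N -> Ck_map A C k mu -> chart_dom A p z -> chart_dom C c (mu z) ->
  C1_at (chart_map C c \o mu \o chart_inv A p) (chart_map A p z).
Proof.
move=> k0 Cmu pz cz; apply: Ck_map_C1_at Cmu _ _ _ => //.
exact: circle_dom_open.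
Qed.

(** Circle charts differ locally by translations, so only the source chart has to be corrected,
    whatever the chart [c] of the target. *)
Lemma tmap_circle_chart k (mu : T -> circle R) p z c u :
  (0 < k)%N -> Ck_map A C k mu -> chart_dom A p z -> chart_dom C c (mu z) ->
  'd (chart_map C c \o mu \o chart_inv A p) (chart_map A p z) u =
  tmap A C mu z (chart_change A p z z u).
Proof.
move=> k0 Cmu pz cz; have zz := chart_dom_self mA z.
have czz := circle_chart_dom_center (mu z).
have [l lE] := circle_map_near (Cmu.1 z I) cz czz.
have /C1_at_diff dz := Ck_map_circle_C1_at k0 Cmu pz czz.
have [_ ->] := is_diff_near_cst (chart_inv_near mA pz lE) dz.
have /C1_at_diff dzz := Ck_map_circle_C1_at k0 Cmu zz czz.
by have [_ ->] := is_diff_chart_change mA pz zz dzz.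
Qed.

Hypothesis mB : is_manifold B.

(** Passage from the tangent map, tied to the charts at [z] and [h z], to a derivative in fixed
    charts, whose dependence on [z] can be controlled. *)
Lemma tmap_chart k (h : T -> T') p z q u :
  (0 < k)%N -> Ck_map A B k h -> chart_dom A p z -> chart_dom B q (h z) ->
  'd (chart_map B q \o h \o chart_inv A p) (chart_map A p z) u =
  chart_change B (h z) q (h z) (tmap A B h z (chart_change A p z z u)).
Proof.
move=> k0 Ch pz qz; have zz := chart_dom_self mA z.
have hzz := chart_dom_self mB (h z).
have /C1_at_diff dq := Ck_map_C1_at mA k0 Ch zz (chart_dom_open mB q) qz.
have [_ ->] := is_diff_chart_change mA (phi := chart_map B q \o h) pz zz dq.
have /C1_at_diff dh := Ck_map_C1_at mA k0 Ch zz (chart_dom_open mB _) hzz.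
have /C1_at_diff dt := chart_transition_C1 mB hzz qz.
by have [_ ->] := is_diff_rep mA mB zz hzz (Ch.1 z I) dh dt.
Qed.

Lemma is_diff_circle_comp k l (h : T -> T') (mu : T' -> circle R) z :
  (0 < k)%N -> (0 < l)%N -> Ck_map A B k h -> Ck_map B C l mu ->
  is_diff (chart_map A z z)
    (chart_map C (mu (h z)) \o (mu \o h) \o chart_inv A z)
    (tmap B C mu (h z) \o tmap A B h z).
Proof.
move=> k0 l0 Ch Cmu; have zz := chart_dom_self mA z.
have hzz := chart_dom_self mB (h z).
have /C1_at_diff dh := Ck_map_C1_at mA k0 Ch zz (chart_dom_open mB _) hzz.
have /C1_at_diff dmu := Ck_map_C1_at mB l0 Cmu hzz (@circle_dom_open R _)
  (circle_chart_dom_center (mu (h z))).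
exact: (is_diff_rep (phi := chart_map C (mu (h z)) \o mu) mA mB zz hzz (Ch.1 z I) dh dmu).
Qed.

End TangentMaps.

(** * Product charts on the circle bundle and the differential of the skew product *)

Section BundleCharts.
Context {R : realType} {E : normedModType R} {M : topologicalType}.
Variable A : atlas E M.
Hypothesis mA : is_manifold A.
Local Notation C := (circle_atlas R).
Local Notation AN := (prod_atlas A C).
Local Notation pic := (\pi_(circle R))%qT.

Lemma prod_dom_open q : open (chart_dom AN q).
Proof.
have -> : chart_dom AN q =
    fst @^-1` chart_dom A q.1 `&` snd @^-1` chart_dom C q.2 by [].
apply: openI; apply: open_comp.
- by move=> ? _; exact: cvg_fst.
- exact: chart_dom_open.
- by move=> ? _; exact: cvg_snd.
- exact: circle_dom_open.
Qed.

Lemma circle_chart_change_near c c' z : chart_dom C c' z -> chart_dom C c z ->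
  exists k : R^o, \forall x \near (chart_map C c z : R^o),
    chart_map C c' (chart_inv C c x) = x + k.
Proof.
move=> c'z cz; eexists.
apply: (circle_lift_unique (g := chart_map C c' \o pic) (h := id)).
- apply: continuous_comp; first exact: circle_pi_continuous.
  by rewrite circle_chart_invK; exact: circle_chart_continuous.
- exact: cvg_id.
- by move=> t; rewrite circle_chart_invK.
Qed.

(** The circle component is unchanged because changes of circle charts are translations near the
    point. *)
Lemma chart_change_prod z q u s : chart_dom AN q z ->
  chart_change AN z q z (u, s) = (chart_change A z.1 q.1 z.1 u, s).
Proof.
move=> [qz1 qz2]; have zz1 := chart_dom_self mA z.1.
have [k kE] := circle_chart_change_near qz2 (circle_chart_dom_center z.2).
pose x0 := chart_map AN z z.
have d1 : differentiable (chart_map A q.1 \o chart_inv A z.1) (chart_map A z.1 z.1).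
  by have /C1_at_diff := chart_transition_C1 mA zz1 qz1.
have D1 : is_diff x0 (chart_map A q.1 \o chart_inv A z.1 \o fst)
    ('d (chart_map A q.1 \o chart_inv A z.1) (chart_map A z.1 z.1) \o fst).
  exact: (is_diff_comp (is_diff_proj1 x0) (differentiableP d1)).
have [ds sE] := @is_diff_proj2 R E R^o x0.
have near2 : \forall x \near x0,
    (chart_map C q.2 \o chart_inv C z.2 \o snd) x = x.2 + k.
  have csnd : x.2 @[x --> x0] --> x0.2 by exact: cvg_snd.
  exact: csnd kE.
have D2 := is_diff_near_cst near2 ds; rewrite sE in D2.
have [_ e] := is_diff_pair D1 D2; exact: (congr1 (@^~ (u, s)) e).
Qed.

Lemma tmap_vertical q s : tmap C AN (fun t => (q.1, t)) q.2 s = (0, s).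
Proof.
have [k kE] := circle_chart_change_near (circle_chart_dom_center q.2)
  (circle_chart_dom_center q.2).
have D2 := is_diff_near_cst kE (ex_diff (is_diff_def := is_diff_id _)).
rewrite (diff_val (is_diff_def := is_diff_id _)) in D2.
have D1 := @is_diff_cst R R^o E (chart_map A q.1 q.1) (chart_map C q.2 q.2).
have [_ e] := is_diff_pair D1 D2; exact: (congr1 (@^~ s) e).
Qed.

Variables (f : M -> M) (gamma : M -> circle R) (r : nat).
Hypotheses (r_gt0 : (0 < r)%N) (Cf : Ck_map A A r f) (Cgamma : Ck_map A C r gamma).

Lemma tmap_skew_product q u s :
  tmap AN AN (skew_product f gamma) q (u, s) =
  (tmap A A f q.1 u, s + tmap A C gamma q.1 u).
Proof.
have zz := chart_dom_self mA q.1; have fz := chart_dom_self mA (f q.1).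
have gz := circle_chart_dom_center (gamma q.1).
have /C1_at_diff/differentiableP df :=
  Ck_map_C1_at mA r_gt0 Cf zz (chart_dom_open mA _) fz.
have /C1_at_diff/differentiableP dg := Ck_map_circle_C1_at mA r_gt0 Cgamma zz gz.
pose x0 := chart_map AN q q.
have D1 := is_diff_comp (is_diff_proj1 x0) df.
have D2 := is_diffD (is_diff_proj2 x0) (is_diff_comp (is_diff_proj1 x0) dg).
pose c := q.2 + gamma q.1.
(* [lift] adds the fibre coordinate and the lifted [gamma] in the reals. The actual chart expression
   projects to the same point of the circle, so near [x0] it differs from [lift] by a constant. *)
set lift := (snd + _) in D2.
have pilift x : pic (lift x) = pic x.2 + gamma (chart_inv A q.1 x.1).
  by rewrite /lift circle_piD circle_chart_invK.
have lc : {for x0, continuous lift}.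
  exact/differentiable_continuous/(ex_diff (is_diff_def := D2)).
have pilift0 : pic (lift x0) = c.
  by rewrite pilift /x0 /= (chart_mapK mA)// circle_chart_invK.
have gc : {for x0, continuous (fun x : E * R^o =>
    chart_map C c (pic x.2 + gamma (chart_inv A q.1 x.1)) : R)}.
  rewrite (_ : (fun x => _) = chart_map C c \o (pic \o lift)); last first.
    by apply/funext => x; rewrite -pilift.
  apply: continuous_comp.
    by apply: (continuous_comp lc); exact: circle_pi_continuous.
  rewrite [(_ \o _) _]pilift0; apply: circle_chart_continuous.
  exact: circle_chart_dom_center.
have near2 := circle_lift_unique gc lc
  (fun x => etrans (circle_chart_invK _ _) (esym (pilift x))).
have D3 := is_diff_near_cst near2 (ex_diff (is_diff_def := D2)).
rewrite (diff_val (is_diff_def := D2)) in D3.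
have [_ e] := is_diff_pair D1 D3; exact: (congr1 (@^~ (u, s)) e).
Qed.

End BundleCharts.

(** * Base and circle components of a map into the circle bundle *)

Section MapsToBundle.
Context {R : realType} {E E' : normedModType R} {M S : topologicalType}.
Variables (A : atlas E M) (B : atlas E' S).
Hypotheses (mA : is_manifold A) (mB : is_manifold B).
Local Notation C := (circle_atlas R).
Local Notation AN := (prod_atlas A C).
Variables (k : nat) (i : S -> M * circle R).
Hypotheses (k_gt0 : (0 < k)%N) (Ci : Ck_map B AN k i).

Let C1_at_i p z m : chart_dom B p z -> chart_dom AN m (i z) ->
  C1_at (chart_map AN m \o i \o chart_inv B p) (chart_map B p z).
Proof.
by move=> pz mz; apply: Ck_map_C1_at Ci _ _ _ => //; exact: prod_dom_open.
Qed.

Lemma Ck_map_fst : Ck_map B A 1 (fst \o i).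
Proof.
split=> [z _|p q].
  by apply: continuous_comp; [exact: Ci.1|exact: cvg_fst].
apply: C1_at_Ck_on => _ [z [[_ pz] qz] <-].
have czz := circle_chart_dom_center (i z).2.
exact: (C1_at_fst (C1_at_i (m := (q, (i z).2)) pz (conj qz czz))).
Qed.

Lemma Ck_map_snd : Ck_map B C 1 (snd \o i).
Proof.
split=> [z _|p q].
  by apply: continuous_comp; [exact: Ci.1|exact: cvg_snd].
apply: C1_at_Ck_on => _ [z [[_ pz] qz] <-].
have zz := chart_dom_self mA (i z).1.
exact: (C1_at_snd (C1_at_i (m := ((i z).1, q)) pz (conj zz qz))).
Qed.

Lemma tmap_prod s v :
  tmap B AN i s v = (tmap B A (fst \o i) s v, tmap B C (snd \o i) s v).
Proof.
have is_c : chart_dom AN (i s) (i s).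
  by split; [exact: chart_dom_self|exact: circle_chart_dom_center].
have /C1_at_diff di := C1_at_i (chart_dom_self mB s) is_c.
have [_ e1] := is_diff_fst di; have [_ e2] := is_diff_snd di.
rewrite [LHS]surjective_pairing; congr (_, _).
  exact: (esym (congr1 (@^~ v) e1)).
exact: (esym (congr1 (@^~ v) e2)).
Qed.

End MapsToBundle.

(** * Graphs of linear forms as planes *)

Section GraphSpace.
Variable R : realType.
Local Notation plane := 'rV[R]_2.
Local Notation space := (plane * R^o)%type.
Implicit Types (l : {linear plane -> R^o}) (u : plane) (y : space).

Definition graph_fun l u : space := (u, l u).

Fact graph_fun_linear l : linear (graph_fun l).
Proof. by move=> a u v; rewrite /graph_fun linearP. Qed.

HB.instance Definition _ l :=
  GRing.isLinear.Build R plane space *:%R (graph_fun l) (graph_fun_linear l).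

Definition graph_space l : {vspace space} := limg (linfun (graph_fun l)).

Lemma mem_limg (U V : vectType R) (g : {linear U -> V}) (y : V) :
  reflect (exists x, y = g x) (y \in limg (linfun g)).
Proof.
apply: (iffP memv_imgP) => [[u _ ->]|[u ->]]; exists u; rewrite ?lfunE//.
by rewrite memvf.
Qed.

(** In the application [L] carries coordinates in a fixed chart to those in the chart at the moving
    point, so one formula frames the plane field over a whole chart domain. *)
Lemma limg_plane_span (V : vectType R) (g : {linear plane -> V})
    (L : {linear plane -> plane}) (L' : plane -> plane) : cancel L' L ->
  limg (linfun g) = (<[g (L (delta_mx 0 0)%R)]> + <[g (L (delta_mx 0 1)%R)]>)%VS.
Proof.
move=> LK; apply/vspaceP => y; apply/mem_limg/memv_addP => [[u ->]|].
  exists (L' u 0 0 *: g (L (delta_mx 0 0))); first by rewrite memvZ// memv_line.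
  exists (L' u 0 1 *: g (L (delta_mx 0 1))); first by rewrite memvZ// memv_line.
  by rewrite -{1}[u]LK [L _]linear_planeE linearD !linearZ.
move=> [_ /vlineP[a ->] [_ /vlineP[b ->] ->]].
by exists (a *: L (delta_mx 0 0) + b *: L (delta_mx 0 1)); rewrite linearD !linearZ.
Qed.

Lemma mem_graph_space l y : (y \in graph_space l) = (y.2 == l y.1).
Proof.
apply/mem_limg/eqP => [[u ->]//|e].
by exists y.1; rewrite [LHS]surjective_pairing e.
Qed.

Lemma dim_graph_space l : \dim (graph_space l) = 2%N.
Proof.
rewrite limg_dim_eq; first by rewrite dimvf /dim /= mul1n.
apply/eqP; rewrite -subv0; apply/subvP => u /memv_capP[_].
by rewrite memv_ker lfunE /= => /eqP[-> _]; rewrite mem0v.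
Qed.

End GraphSpace.

(** * The invariant plane field *)

Section InvariantPlaneField.
Context {R : realType} {M : topologicalType}.
Local Notation plane := 'rV[R]_2.
Variable A : atlas plane M.
Hypothesis mA : is_manifold A.
Local Notation C := (circle_atlas R).
Local Notation AN := (prod_atlas A C).
Local Notation pic := (\pi_(circle R))%qT.
Variable mu : M -> circle R.
Hypothesis Cmu : Ck_map A C 1 mu.

Definition plane_field (q : M * circle R) : {vspace (plane * R^o)%type} :=
  graph_space (tmap A C mu q.1).

Lemma mem_vertical q (y : plane * R^o) : (y \in vertical A q) = (y.1 == 0).
Proof.
apply/mem_limg/eqP => [[s ->]|e]; first by rewrite (tmap_vertical A).
by exists y.2; rewrite (tmap_vertical A) -e -surjective_pairing.
Qed.

Lemma plane_field_transversal q : (plane_field q + vertical A q)%VS = fullv.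
Proof.
apply/vspaceP => y; rewrite memvf; apply/memv_addP.
exists (y.1, tmap A C mu q.1 y.1); first by rewrite mem_graph_space.
exists (0, y.2 - tmap A C mu q.1 y.1); first by rewrite mem_vertical.
by rewrite [LHS]surjective_pairing; congr (_, _); rewrite /= ?addr0// addrC subrK.
Qed.

(** The coordinate field number [k] of the chart at [p], lifted to the graph; the change of charts
    rewrites it in the chart at the moving point. *)
Definition plane_frame p k (z : M * circle R) : plane * R^o :=
  graph_fun (tmap A C mu z.1) (chart_change A p z.1 z.1 (delta_mx 0 k)).

Lemma plane_frame_continuous p k :
  continuous_vector_field_on AN (chart_dom A p `*` setT) (plane_frame p k).
Proof.
move=> q; apply: continuous_in_subspaceT => z; rewrite inE => -[[pz _] qz].
pose c := mu z.1; have cz := circle_chart_dom_center c.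
pose e : plane := delta_mx 0 k.
(* The frame seen in the chart at [q]: first derivatives of a transition map and of a lift of [mu],
   both in fixed charts, hence continuous. *)
pose Y (y : M * circle R) : plane * R^o :=
  ('d (chart_map A q.1 \o chart_inv A p) (chart_map A p y.1) e,
   'd (chart_map C c \o mu \o chart_inv A p) (chart_map A p y.1) e).
have c1 : y.1 @[y --> z] --> z.1 by exact: cvg_fst.
have cp : {for z, continuous (fun y : M * circle R => chart_map A p y.1)}.
  by apply: continuous_comp; [exact: c1|exact: chart_map_continuous].
have XY : \forall y \near z, Y y = chart_change AN y q y (plane_frame p k y).
  have nq : \forall y \near z, chart_dom AN q y.
    exact: open_nbhs_nbhs (conj (@prod_dom_open _ _ _ _ mA q) qz).
  have np : \forall y \near z, chart_dom A p y.1.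
    exact: (c1 _ (open_nbhs_nbhs (conj (chart_dom_open mA p) pz))).
  have nc : \forall y \near z, chart_dom C c (mu y.1).
    exact: (c1 _ (Cmu.1 _ I _ (open_nbhs_nbhs (conj (@circle_dom_open R c) cz)))).
  near=> y.
  have qy : chart_dom AN q y by near: y.
  have py : chart_dom A p y.1 by near: y.
  have cy : chart_dom C c (mu y.1) by near: y.
  have [qy1 _] := qy; have yy := chart_dom_self mA y.1.
  apply: etrans (esym (chart_change_prod mA _ _ qy)); congr (_, _).
    exact: (esym (chart_change_comp mA _ py yy qy1)).
  exact: (tmap_circle_chart mA _ (ltn0Sn 0) Cmu py cy).
have Yc : {for z, continuous Y}.
  have [_ /(_ e) h1] := chart_transition_C1 mA pz qz.1.
  have [_ /(_ e) h2] := Ck_map_circle_C1_at mA (ltn0Sn 0) Cmu pz cz.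
  exact: (cvg_pair (continuous_comp cp h1) (continuous_comp cp h2)).
exact: (continuous_near XY Yc).
Unshelve. all: by end_near. Qed.

Lemma plane_field_subbundle : plane_subbundle A plane_field.
Proof.
split=> [q|q]; first exact: dim_graph_space.
pose p := q.1.
exists (chart_dom A p `*` setT), (plane_frame p 0), (plane_frame p 1); split.
- split; last by split; [exact: chart_dom_self|].
  have -> : chart_dom A p `*` [set: circle R] = fst @^-1` chart_dom A p.
    by apply/seteqP; split=> [x []|x].
  apply: open_comp; first by move=> ? _; exact: cvg_fst.
  exact: chart_dom_open.
- exact: plane_frame_continuous.
- exact: plane_frame_continuous.
- move=> z [pz _]; have zz := chart_dom_self mA z.1.
  have K : cancel (chart_change A z.1 p z.1) (chart_change A p z.1 z.1).
    by move=> u; exact: chart_changeK.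
  exact: (limg_plane_span (graph_fun (tmap A C mu z.1)) K).
Qed.

Variables (f f' : M -> M) (gamma : M -> circle R) (r : nat).
Hypotheses (r_gt0 : (0 < r)%N) (Cf : Ck_map A A r f) (Cf' : Ck_map A A r f').
Hypotheses (fK : cancel f f') (f'K : cancel f' f).
Hypotheses (Cgamma : Ck_map A C r gamma) (cob : coboundary f gamma mu).

(** Chain rule applied to [f \o f' = id]; it provides the surjectivity of [D f]. *)
Lemma tmap_inv z v : tmap A A f (f' z) (tmap A A f' z v) = v.
Proof.
have zz := chart_dom_self mA z; have fz := chart_dom_self mA (f' z).
have ffz := chart_dom_self mA (f (f' z)).
have /C1_at_diff df' := Ck_map_C1_at mA r_gt0 Cf' zz (chart_dom_open mA _) fz.
have /C1_at_diff df := Ck_map_C1_at mA r_gt0 Cf fz (chart_dom_open mA _) ffz.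
have [_ /(congr1 (@^~ v)) /= <-] :=
  is_diff_rep (phi := chart_map A (f (f' z)) \o f) mA mA zz fz (Cf'.1 z I) df' df.
have near_id : \forall x \near chart_map A z z,
    id x = ((chart_map A (f (f' z)) \o f) \o f' \o chart_inv A z) x.
  by rewrite f'K; apply: filterS (chart_invK_near mA zz) => x /= E; rewrite f'K E.
have [_ ->] := is_diff_near near_id (ex_diff (is_diff_def := is_diff_id _)).
by rewrite (diff_val (is_diff_def := is_diff_id _)).
Qed.

Lemma tmap_coboundary p u :
  tmap A C mu (f p) (tmap A A f p u) = tmap A C mu p u + tmap A C gamma p u.
Proof.
have pp := chart_dom_self mA p.
have cm := circle_chart_dom_center (mu p).
have cg := circle_chart_dom_center (gamma p).
have cf := circle_chart_dom_center (mu (f p)).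
have [_ E1] := is_diff_circle_comp mA mA p r_gt0 (ltn0Sn 0) Cf Cmu.
have /C1_at_diff/differentiableP dm := Ck_map_circle_C1_at mA (ltn0Sn 0) Cmu pp cm.
have /C1_at_diff/differentiableP dg := Ck_map_circle_C1_at mA r_gt0 Cgamma pp cg.
(* The three charts are unrelated, so the lifts of the two sides of [mu \o f = mu + gamma] agree
   near [p] only up to their difference at [p]. *)
have nearE : \forall y \near p, chart_map C (mu (f p)) (mu (f y)) =
    (chart_map C (mu p) (mu y) : R) + chart_map C (gamma p) (gamma y) +
    (chart_map C (mu (f p)) (mu (f p)) -
     ((chart_map C (mu p) (mu p) : R) + chart_map C (gamma p) (gamma p))).
  apply: (circle_lift_unique (g := chart_map C (mu (f p)) \o (mu \o f))).
  - apply: continuous_comp; last exact: circle_chart_continuous.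
    by apply: continuous_comp; [exact: Cf.1|exact: Cmu.1].
  - apply: cvgD.
      by apply: continuous_comp (Cmu.1 p I) _; exact: circle_chart_continuous.
    by apply: continuous_comp (Cgamma.1 p I) _; exact: circle_chart_continuous.
  - by move=> y; rewrite circle_piD !circle_chart_invK cob addrC subrK.
have ds := is_diffD dm dg.
have [_ E2] := is_diff_near_cst (chart_inv_near mA pp nearE)
  (ex_diff (is_diff_def := ds)).
have E3 := diff_val (is_diff_def := ds).
exact: etrans (esym (congr1 (@^~ u) E1)) (congr1 (@^~ u) (etrans E2 E3)).
Qed.

Lemma plane_field_invariant :
  invariant_subbundle A (skew_product f gamma) plane_field.
Proof.
move=> q; apply/vspaceP => y; rewrite mem_graph_space; apply/memv_imgP/eqP.
  move=> [[u s]]; rewrite mem_graph_space => /eqP sE ->.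
  rewrite lfunE (tmap_skew_product mA r_gt0 Cf Cgamma q u s).
  exact: etrans (congr1 (+%R^~ _) sE) (esym (tmap_coboundary q.1 u)).
(* Reverse inclusion: the preimage is the graph vector over the image of [y.1] under the
   differential of the inverse of [f]. *)
move=> e; pose u := tmap A A f' (f q.1) y.1.
have uE : tmap A A f q.1 u = y.1.
  by have := tmap_inv (f q.1) y.1; rewrite fK.
exists (u, tmap A C mu q.1 u); first by rewrite mem_graph_space.
rewrite lfunE; apply: etrans (esym (tmap_skew_product mA r_gt0 Cf Cgamma q _ _)).
rewrite [LHS]surjective_pairing e -uE; congr (_, _).
exact: tmap_coboundary.
Qed.

End InvariantPlaneField.

Section CircleComp.
Context {R : realType} {E : normedModType R} {n : nat} {T T' : topologicalType}.
Variables (A : atlas E T) (B : atlas 'rV[R]_n T').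
Hypotheses (mA : is_manifold A) (mB : is_manifold B).
Local Notation C := (circle_atlas R).

Lemma Ck_map_circle_comp (h : T -> T') (mu : T' -> circle R) :
  Ck_map A B 1 h -> Ck_map B C 1 mu -> Ck_map A C 1 (mu \o h).
Proof.
move=> Ch Cmu; split=> [z _|p c].
  by apply: continuous_comp; [exact: Ch.1|exact: Cmu.1].
apply: C1_at_Ck_on => _ [z [[_ pz] cz] <-].
have hz := chart_dom_self mB (h z).
have C1 := Ck_map_C1_at mA (ltn0Sn 0) Ch pz (chart_dom_open mB _) hz.
have C2 := Ck_map_circle_C1_at mB (ltn0Sn 0) Cmu hz cz.
exact: (C1_at_rep (phi := chart_map C c \o mu) mA mB pz hz (Ch.1 z I) C1 C2).
Qed.

End CircleComp.

(** * The characteristic vector field *)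

Lemma scalar_sub {R : realType} {V : lmodType R} (g h : {linear V -> R^o}) :
  scalar (fun v => g v - h v : R).
Proof.
move=> k u v; rewrite (linearP g k u v) (linearP h k u v) /= opprD addrACA; congr (_ + _).
by rewrite -[k *: g u]/(k * g u) -[k *: h u]/(k * h u) -mulrBr.
Qed.

Section CharacteristicField.
Context {R : realType} {M S : topologicalType}.
Local Notation plane := 'rV[R]_2.
Variables (A : atlas plane M) (B : atlas plane S).
Hypotheses (mA : is_manifold A) (mB : is_manifold B).
Local Notation C := (circle_atlas R).
Local Notation AN := (prod_atlas A C).
Variables (w : M -> plane -> plane -> R) (mu : M -> circle R).
Hypotheses (area_w : area_form A w) (Cmu : Ck_map A C 1 mu).
Variable i : S -> M * circle R.
Hypotheses (Ci : Ck_map B AN 1 i) (trans_i : transversal_hypersurface A B i).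

Local Notation a := (fst \o i).
Local Notation b := (snd \o i).
Local Notation d := (mu \o a).

Let Ca : Ck_map B A 1 a := Ck_map_fst mA mB (ltn0Sn 0) Ci.
Let Cb : Ck_map B C 1 b := Ck_map_snd mA mB (ltn0Sn 0) Ci.
Let Cd : Ck_map B C 1 d := Ck_map_circle_comp mB mA Ca Cmu.

(** Vertical vectors have zero base component, so transversality forces the tangent plane of the
    surface to project onto that of [M]. *)
Lemma tmap_surj s u : exists v, tmap B A a s v = u.
Proof.
have : (u, 0) \in (tangent_plane A B i s + vertical A (i s))%VS.
  by rewrite trans_i memvf.
move=> /memv_addP[_ /mem_limg[v ->] [y]]; rewrite mem_vertical => /eqP y0 uE.
exists v; have := congr1 fst uE; rewrite (tmap_prod mA mB (ltn0Sn 0) Ci) /=.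
by rewrite y0 addr0 => ->.
Qed.

Lemma induced_form_symplectic s : symplectic_form (induced_form A B w i s).
Proof. exact: symplectic_pullback (area_w.1 _) (tmap_surj s). Qed.

(* The differential of [snd \o i - mu \o fst \o i], whose kernel is the trace on
   the surface of the plane field. *)
Definition defect s (v : plane) : R := tmap B C b s v - tmap B C d s v.

Lemma defect_scalar s : scalar (defect s).
Proof.
exact: scalar_sub.
Qed.

Lemma tmap_mem_plane_field s v :
  (tmap B AN i s v \in plane_field A mu (i s)) = (defect s v == 0).
Proof.
rewrite mem_graph_space (tmap_prod mA mB (ltn0Sn 0) Ci) subr_eq0.
have [_ e] := is_diff_circle_comp mB mA s (ltn0Sn 0) (ltn0Sn 0) Ca Cmu.
by rewrite [X in _ = (_ == X)](congr1 (@^~ v) e).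
Qed.

Definition char_field s : plane := sharp (induced_form A B w i s) (defect s).

Lemma char_fieldE s v : induced_form A B w i s (char_field s) v = defect s v.
Proof. by apply: sharpE; [exact: induced_form_symplectic|exact: defect_scalar]. Qed.

(** The defect is the form dual to [char_field], so one vanishes exactly when the other does, that
    is, when the surface is tangent to the plane field. Otherwise its kernel is the line of
    [char_field]. *)
Lemma char_field_generates s :
  if plane_field A mu (i s) == tangent_plane A B i s then char_field s = 0
  else <[tmap B AN i s (char_field s)]>%VS =
       (plane_field A mu (i s) :&: tangent_plane A B i s)%VS.
Proof.
have Dv v : tmap B AN i s v \in tangent_plane A B i s by apply/mem_limg; exists v.
have sF := induced_form_symplectic s.
have [[bF aF _] [abF c0]] := (sF, (symplectic_planeP _).1 sF).
have [e|ne] := eqVneq (plane_field A mu (i s)) (tangent_plane A B i s).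
  apply: (symplectic_inj sF) => v; rewrite char_fieldE.
  have : tmap B AN i s v \in plane_field A mu (i s) by rewrite e.
  rewrite tmap_mem_plane_field => /eqP ->.
  by rewrite (alternating_planeE _ _ abF) !mxE !mul0r subrr mulr0.
(* With a zero field the tangent plane lies in the graph. Conversely, a vector of the graph has the
   base component of some tangent vector, and two graph vectors over the same base vector
   coincide. *)
have X0 : char_field s != 0.
  apply: contra_neq ne => X0; apply/vspaceP => y; apply/idP/idP.
    rewrite mem_graph_space => /eqP yE; have [v vE] := tmap_surj s y.1.
    suff -> : y = tmap B AN i s v by [].
    have : tmap B AN i s v \in plane_field A mu (i s).
      rewrite tmap_mem_plane_field -char_fieldE X0.
      by rewrite (alternating_planeE _ _ abF) !mxE !mul0r subrr mulr0.
    rewrite mem_graph_space => /eqP.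
    have e1 : (tmap B AN i s v).1 = y.1.
      by rewrite (tmap_prod mA mB (ltn0Sn 0) Ci).
    rewrite e1 -yE => e2.
    by rewrite [LHS]surjective_pairing [RHS]surjective_pairing e1 e2.
  move=> /mem_limg[v ->]; rewrite tmap_mem_plane_field -char_fieldE X0.
  by rewrite (alternating_planeE _ _ abF) !mxE !mul0r subrr mulr0.
apply/vspaceP => y; apply/vlineP/memv_capP => [[k ->]|[yxi]].
  split; apply: rpredZ => //.
  by rewrite tmap_mem_plane_field -char_fieldE aF.
move=> /mem_limg[v yE]; move: yxi; rewrite yE tmap_mem_plane_field.
(* The defect of [v] is a nonzero multiple of the determinant of [char_field s] and [v], so its
   vanishing means collinearity. *)
rewrite -char_fieldE (alternating_planeE _ _ abF) mulf_eq0 (negbTE c0) /=.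
move=> /eqP /(plane_collinear X0)[k ->]; exists k.
by rewrite linearZ.
Qed.

(* [snd \o i - mu \o fst \o i], lifted to the reals near [p]. *)
Definition local_hamiltonian p z : R^o :=
  (chart_map C (b p) (b z) : R^o) - chart_map C (d p) (d z).

Definition hamiltonian_dom p : set S :=
  b @^-1` chart_dom C (b p) `&` d @^-1` chart_dom C (d p).

Lemma hamiltonian_dom_self p : hamiltonian_dom p p.
Proof. by split; exact: circle_chart_dom_center. Qed.

Lemma hamiltonian_dom_open p : open (hamiltonian_dom p).
Proof.
apply: openI; apply: open_comp => [z _|]; try exact: circle_dom_open.
  exact: Cb.1.
exact: Cd.1.
Qed.

Lemma local_hamiltonian_C1 p q z : chart_dom B q z -> hamiltonian_dom p z ->
  C1_at (local_hamiltonian p \o chart_inv B q) (chart_map B q z).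
Proof.
move=> qz [bz dz].
have C1 := Ck_map_circle_C1_at mB (ltn0Sn 0) Cb qz bz.
have C2 := Ck_map_circle_C1_at mB (ltn0Sn 0) Cd qz dz.
exact: (C1_atB C1 C2).
Qed.

Lemma diff_local_hamiltonian p q z u :
  chart_dom B q z -> hamiltonian_dom p z ->
  'd (local_hamiltonian p \o chart_inv B q) (chart_map B q z) u =
  defect z (chart_change B q z z u).
Proof.
move=> qz [bz dz].
have /C1_at_diff D1 := Ck_map_circle_C1_at mB (ltn0Sn 0) Cb qz bz.
have /C1_at_diff D2 := Ck_map_circle_C1_at mB (ltn0Sn 0) Cd qz dz.
have e1 := tmap_circle_chart mB u (ltn0Sn 0) Cb qz bz.
have e2 := tmap_circle_chart mB u (ltn0Sn 0) Cd qz dz.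
apply: etrans (congr1 (@^~ u) (diffB D1 D2)) _.
exact: (congr2 (fun x y : R => x - y) e1 e2).
Qed.

Lemma char_field_hamiltonian :
  locally_hamiltonian B (induced_form A B w i) char_field.
Proof.
move=> p; exists (hamiltonian_dom p), (local_hamiltonian p); split.
- by split; [exact: hamiltonian_dom_open|exact: hamiltonian_dom_self].
- split=> [z [bz dz]|q q'].
    apply: cvgB.
      by apply: continuous_comp (Cb.1 z I) _; exact: circle_chart_continuous.
    by apply: continuous_comp (Cd.1 z I) _; exact: circle_chart_continuous.
  by apply: C1_at_Ck_on => _ [z [[Uz qz] _] <-]; exact: local_hamiltonian_C1.
(* The compatible pairs disappear here; what remains is that contracting the induced form with the
   field gives the differential of the local hamiltonian. *)
- move=> z Uz; apply/(hamiltonian_vectorP _ _ (induced_form_symplectic z)) => v.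
  have zz := chart_dom_self mB z.
  rewrite char_fieldE -[v in LHS](chart_change_id mB v zz).
  exact: (esym (diff_local_hamiltonian v zz Uz)).
Qed.

(** In the fixed chart at [q] the field is given by the formula of [sharp]. Its ingredients are the
    coefficient of the area form, the Jacobian of the projection to [M] and the partial derivatives
    of the local hamiltonian, all continuous at [z0]. *)
Lemma char_field_continuous : continuous_vector_field_on B setT char_field.
Proof.
move=> q; apply: continuous_in_subspaceT => z0; rewrite inE => -[_ qz0].
pose m := a z0; have mm : chart_dom A m m := chart_dom_self mA m.
pose e (k : 'I_2) : plane := delta_mx 0 k.
pose H := local_hamiltonian z0.
pose G (x : plane) : R^o := let y := chart_inv A m x in
  w y (chart_change A m y y (e 0)) (chart_change A m y y (e 1)).
pose D k z := 'd (chart_map A m \o a \o chart_inv B q) (chart_map B q z) (e k).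
(* Coefficient of the induced form in the chart at [q]: that of [w] in the chart at [m], times the
   Jacobian determinant of [fst \o i]. *)
pose c z : R := G (chart_map A m (a z)) *
  (D 0 z 0 0 * D 1 z 0 1 - D 0 z 0 1 * D 1 z 0 0).
pose h k z : R := 'd (H \o chart_inv B q) (chart_map B q z) (e k).
pose Y z : plane := (c z)^-1 *: (h 1 z *: e 0 - h 0 z *: e 1).
have cq := chart_map_continuous mB qz0.
have Dc k : {for z0, continuous (D k)}.
  have [_ /(_ (e k)) hc] := Ck_map_C1_at mB (ltn0Sn 0) Ca qz0 (chart_dom_open mA _) mm.
  exact: (continuous_comp cq hc).
have hc k : {for z0, continuous (h k)}.
  have [_ /(_ (e k)) hk] := local_hamiltonian_C1 qz0 (hamiltonian_dom_self z0).
  exact: (continuous_comp cq hk).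
have Dcoord k l : {for z0, continuous (fun z => D k z 0 l : R)}.
  apply: (@continuous_comp _ _ _ (D k) (fun M : plane => M 0 l)) => //.
  exact: coord_continuous.
have Gc : {for z0, continuous (fun z => G (chart_map A m (a z)) : R)}.
  have Gm : {for chart_map A m m, continuous G}.
    by apply: (area_w.2 0%N m (e 0) (e 1)); exists m.
  apply: (@continuous_comp _ _ _ (fun z => chart_map A m (a z)) G) => //.
  by apply: continuous_comp (Ca.1 z0 I) _; exact: chart_map_continuous.
have cc : {for z0, continuous c}.
  by apply: cvgM; [exact: Gc|apply: cvgB; apply: cvgM; exact: Dcoord].
have formE z : chart_dom B q z -> chart_dom A m (a z) ->
    induced_form A B w i z (chart_change B q z z (e 0)) (chart_change B q z z (e 1)) =
    c z.
  move=> qz mz; have az := chart_dom_self mA (a z).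
  have DE k : tmap B A a z (chart_change B q z z (e k)) =
      chart_change A m (a z) (a z) (D k z).
    have tE := tmap_chart mB mA (e k) (ltn0Sn 0) Ca qz mz.
    apply: etrans (esym (chart_changeK mA _ az mz)) _.
    exact: congr1 (esym tE).
  have sW : symplectic_form (fun u v =>
      w (a z) (chart_change A m (a z) (a z) u) (chart_change A m (a z) (a z) v)).
    apply: symplectic_pullback (area_w.1 _) _ => u.
    by exists (chart_change A (a z) m (a z) u); exact: chart_changeK.
  have [abW _] := (symplectic_planeP _).1 sW.
  apply: etrans (congr2 (w (a z)) (DE 0) (DE 1)) _.
  apply: etrans (alternating_planeE (D 0 z) (D 1 z) abW) _.
  by rewrite /c /G (chart_mapK mA mz).
have omega z : chart_dom B q z -> symplectic_form (fun u v =>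
    induced_form A B w i z (chart_change B q z z u) (chart_change B q z z v)).
  move=> qz; apply: symplectic_pullback (induced_form_symplectic z) _ => u.
  exists (chart_change B z q z u); apply: chart_changeK => //.
  exact: chart_dom_self.
have c0 : c z0 != 0.
  rewrite -formE//; exact: ((symplectic_planeP _).1 (omega z0 qz0)).2.
have XY : \forall z \near z0, Y z = chart_change B z q z (char_field z).
  have nq : \forall z \near z0, chart_dom B q z.
    exact: open_nbhs_nbhs (conj (chart_dom_open mB q) qz0).
  have nm : \forall z \near z0, chart_dom A m (a z).
    exact: (Ca.1 z0 I _ (open_nbhs_nbhs (conj (chart_dom_open mA m) mm))).
  have nU : \forall z \near z0, hamiltonian_dom z0 z.
    exact: open_nbhs_nbhs (conj (hamiltonian_dom_open z0) (hamiltonian_dom_self z0)).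
  near=> z.
  have qz : chart_dom B q z by near: z.
  have mz : chart_dom A m (a z) by near: z.
  have Uz : hamiltonian_dom z0 z by near: z.
  have zz := chart_dom_self mB z.
  pose F u v := induced_form A B w i z (chart_change B q z z u) (chart_change B q z z v).
  have YE : Y z = sharp F (fun u => defect z (chart_change B q z z u)).
    rewrite /Y /sharp /h !diff_local_hamiltonian//.
    by rewrite -formE.
  have la : scalar (fun u => defect z (chart_change B q z z u)).
    by move=> k u v; rewrite linearP; exact: defect_scalar.
  (* Both vectors have the same contraction with the induced form, so nondegeneracy identifies them;
     this moves the formula from the chart at [z] to the one at [q]. *)
  have -> : char_field z = chart_change B q z z (Y z).
    apply: (symplectic_inj (induced_form_symplectic z)) => v.
    rewrite char_fieldE YE -[v](chart_changeK mB _ zz qz).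
    exact: (esym (sharpE _ (omega z qz) la)).
  by rewrite (chart_changeK mB _ qz zz).
exact: (continuous_near XY (cvg_sharp cc (hc 0) (hc 1) c0)).
Unshelve. all: by end_near. Qed.

End CharacteristicField.

Theorem theorem1p2 (R : realType) (M : topologicalType)
    (A : atlas 'rV[R]_2 M) (w : M -> 'rV[R]_2 -> 'rV[R]_2 -> R)
    (r : nat) (f : M -> M) (gamma mu : M -> circle R) :
  is_manifold A -> compact [set: M] -> area_form A w ->
  (1 <= r)%N ->
  anosov_diffeo A r f -> area_preserving A w f ->
  Ck_map A (circle_atlas R) r gamma ->
  Ck_map A (circle_atlas R) 1 mu ->
  coboundary f gamma mu ->
  exists xi : M * circle R -> {vspace ('rV[R]_2 * R^o)%type},
  [/\ plane_subbundle A xi,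
      invariant_subbundle A (skew_product f gamma) xi,
      (forall q, (xi q + vertical A q)%VS = fullv) &
      forall (S : topologicalType) (B : atlas 'rV[R]_2 S)
             (i : S -> M * circle R),
        is_manifold B -> C1_embedding A B i -> transversal_hypersurface A B i ->
        exists X : S -> 'rV[R]_2,
          represents_characteristic_foliation A B xi i X /\
          locally_hamiltonian B (induced_form A B w i) X].
Proof.
move=> mA _ area_w r_gt0 [f' [[fK f'K] [Cf Cf'] _]] _ Cgamma Cmu cob.
exists (plane_field A mu); split.
- exact: plane_field_subbundle.
- exact: (plane_field_invariant mA Cmu r_gt0 Cf Cf' fK f'K Cgamma cob).
- exact: plane_field_transversal.
- move=> S B i mB [Ci _ _ _] trans_i; exists (char_field A B w mu i); split.
    split; first exact: (char_field_continuous mA mB area_w Cmu Ci trans_i).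
    exact: (char_field_generates mA mB area_w Cmu Ci trans_i).
  exact: (char_field_hamiltonian mA mB area_w Cmu Ci trans_i).
Qed.
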